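(* Let $(H,\circ)$ be a $\le$-hypergroupoid. If $L$ is a left ideal of $H$, then the characteristic function $f_L$ is a fuzzy left ideal of $H$. Conversely, if $L$ is a nonempty subset of $H$ such that $f_L$ is a fuzzy left ideal of $H$, then $L$ is a left ideal of $H$.
   Context: Let ${\cal P}^*(H)$ denote the set of nonempty subsets of $H$. A hypergroupoid $(H,\circ)$ is a nonempty set $H$ with a hyperoperation $\circ : H\times H\to {\cal P}^*(H)$, $(a,b)\mapsto a\circ b$. It induces an operation $*$ on ${\cal P}^*(H)$ by $A*B=\bigcup_{(a,b)\in A\times B}(a\circ b)$. No associativity is assumed. A $\le$-hypergroupoid is a hypergroupoid $H$ endowed with an arbitrary binary relation denoted $\le$ (not necessarily an order, and not assumed compatible with $\circ$); $b\ge a$ means $a\le b$. A nonempty subset $A$ of a $\le$-hypergroupoid $H$ is a left ideal of $H$ if (1) $H*A\subseteq A$ and (2) if $a\in A$, $b\in H$ and $b\le a$, then $b\in A$. A fuzzy subset of $H$ is any mapping $f:H\to[0,1]$. A fuzzy subset $f$ of $H$ is a fuzzy left ideal of $H$ if (1) $x\le y$ implies $f(x)\ge f(y)$ for all $x,y\in H$, and (2) for all $x,y\in H$ and all $u\in x\circ y$, $f(u)\ge f(y)$. For $A\subseteq H$, the characteristic function $f_A:H\to\{0,1\}\subseteq[0,1]$ is given by $f_A(x)=1$ if $x\in A$ and $f_A(x)=0$ if $x\notin A$. *)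

(* Defs.v *)
From mathcomp Require Import all_boot all_order all_algebra.
From mathcomp Require Import classical_sets set_interval reals numfun.

Set Implicit Arguments.
Unset Strict Implicit.
Unset Printing Implicit Defensive.

Import Order.TTheory GRing.Theory Num.Theory.

Local Open Scope classical_set_scope.
Local Open Scope ring_scope.

Record hypergroupoid := Hypergroupoid {
  hg_car :> Type;
  hg_nonempty : [set: hg_car] !=set0;
  hop : hg_car -> hg_car -> set hg_car;
  hop_nonempty : forall a b, hop a b !=set0
}.

(* [hle] is an arbitrary relation: neither an order nor compatible with
   [hop]. *)
Record le_hypergroupoid := LeHypergroupoid {
  lehg_car :> hypergroupoid;
  hle : lehg_car -> lehg_car -> Prop
}.

(* Defined on all subsets; by [hmul_nonempty] it restricts to an operation on
   the nonempty ones. *)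
Definition hmul (H : hypergroupoid) (A B : set H) : set H :=
  \bigcup_(p in A `*` B) hop p.1 p.2.

Lemma hmul_nonempty (H : hypergroupoid) (A B : set H) :
  A !=set0 -> B !=set0 -> hmul A B !=set0.
Proof.
move=> [a Aa] [b Bb]; have [u abu] := hop_nonempty a b.
by exists u; exists (a, b).
Qed.

Definition left_ideal (H : le_hypergroupoid) (A : set H) : Prop :=
  [/\ A !=set0,
      hmul [set: H] A `<=` A
    & forall a b : H, A a -> hle b a -> A b].

Definition fuzzy_subset (R : realType) (H : Type) (f : H -> R) : Prop :=
  forall x, f x \in `[0, 1].

Definition fuzzy_left_ideal (R : realType) (H : le_hypergroupoid)
    (f : H -> R) : Prop :=
  [/\ fuzzy_subset f,
      forall x y : H, hle x y -> f x >= f y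
    & forall x y u : H, hop x y u -> f u >= f y].

(* Main.v *)
Require Import Defs.
From mathcomp Require Import all_boot all_order all_algebra.
From mathcomp Require Import classical_sets set_interval reals numfun.

Import Order.TTheory GRing.Theory Num.Theory.

Local Open Scope classical_set_scope.
Local Open Scope ring_scope.

(** An indicator takes only the values 0 and 1, so an inequality between two of
    its values is an implication between memberships ([le_indicP]).  Read
    through this dictionary, the two inequalities defining a fuzzy left ideal
    become downward closure of [L] and the elementwise form of [H * L `<=` L]
    ([hmul_setT_subP]), so both directions are the same translation. *)

Lemma le_indicP (R : realType) (T : Type) (A : set T) (x y : T) :
  (\1_A x <= \1_A y :> R) <-> (A x -> A y).
Proof.
rewrite !indicE ler_nat; split=> [le_xy /mem_set xA|xy].
  by move: le_xy; rewrite xA lt0b => /set_mem.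
by case: (boolP (x \in A)) => // /set_mem /xy /mem_set ->.
Qed.

Lemma fuzzy_subset_indic (R : realType) (T : Type) (A : set T) :
  fuzzy_subset (\1_A : T -> R).
Proof.
by move=> x; rewrite in_itv /= indicE ler0n lern1 leq_b1.
Qed.

Lemma hmul_setT_subP (H : hypergroupoid) (A : set H) :
  hmul [set: H] A `<=` A <-> (forall x y u : H, hop x y u -> A y -> A u).
Proof.
split=> [sub x y u xyu Ay|closed u [[x y] [_ Ay] xyu]].
  by apply: sub; exists (x, y).
exact: closed xyu Ay.
Qed.

Theorem proposition6 (R : realType) (H : le_hypergroupoid) :
  (forall L : set H,
     left_ideal L -> fuzzy_left_ideal (\1_L : H -> R)) /\
  (forall L : set H, L !=set0 ->
     fuzzy_left_ideal (\1_L : H -> R) -> left_ideal L).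
Proof.
split=> L.
  move=> [_ /hmul_setT_subP mulL downL]; split.
  - exact: fuzzy_subset_indic.
  - by move=> x y xy; apply/le_indicP => Ly; apply: downL xy.
  - by move=> x y u xyu; apply/le_indicP; apply: mulL xyu.
move=> L0 [_ downL mulL]; split=> //.
- by apply/hmul_setT_subP => x y u /mulL /le_indicP.
- by move=> a b La /downL /le_indicP; apply.
Qed.
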